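(* There exists an absolute constant $c>0$ such that the following holds. Let $X$ be a finite set, let $0<p\le 1$, and let $\Lambda$ be a collection of nonnegative weight vectors on $X$ (functions $\lambda:X\to[0,\infty)$) such that $\mathbb E\, Z_\Lambda(X_p)<\infty$. Then for every $0<\delta\le 1$, the family \[ \{A\subseteq X: Z_\Lambda(A)>(1+\delta)\,\mathbb E\, Z_\Lambda(X_p)\} \] is $q$-small for \[ q=\frac{cp}{\log(2/\delta)}. \]
   Context: Logarithms are in base $2$. For a finite set $X$ and $p\in[0,1]$, $X_p$ denotes the random subset of $X$ containing each element independently with probability $p$. For $A\subseteq X$, $Z_\Lambda(A)=\sup_{\lambda\in\Lambda}\sum_{x\in A}\lambda(x)$. A family $\mathcal G\subseteq 2^X$ is a cover of $\mathcal H\subseteq 2^X$ if every $H\in\mathcal H$ contains some $G\in\mathcal G$ as a subset. A family $\mathcal H\subseteq 2^X$ is $q$-small if it has a cover $\mathcal G\subseteq 2^X$ with $\sum_{G\in\mathcal G}q^{|G|}\le \tfrac12$. *)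

(* Defs.v *)
From mathcomp Require Import all_boot all_order all_algebra.
From mathcomp Require Import all_classical all_reals all_analysis.

Set Implicit Arguments.
Unset Strict Implicit.
Unset Printing Implicit Defensive.

Import Order.TTheory GRing.Theory Num.Theory.

Local Open Scope ring_scope.

Definition log2 (R : realType) (x : R) : R := ln x / ln 2.

(* The law of X_p: the probability that X_p = A, each x being in X_p
   independently with probability p. *)
Definition random_subset_pmf (R : realType) (X : finType) (p : R)
    (A : {set X}) : R :=
  \prod_(x : X) (if x \in A then p else 1 - p).

(* Extended-real valued, since f may be infinite; an infinite value carried by
   a null set A contributes 0. *)
Definition expect_random_subset (R : realType) (X : finType) (p : R)
    (f : {set X} -> \bar R) : \bar R :=
  (\sum_(A : {set X}) (random_subset_pmf p A)%:E * f A)%E.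

(* Lambda may be infinite and unbounded, hence the extended-real supremum; it is
   -oo when Lambda is empty. *)
Definition Z (R : realType) (X : finType) (Lambda : set (X -> R))
    (A : {set X}) : \bar R :=
  ereal_sup [set (\sum_(x in A) l x)%:E | l in Lambda]%classic.

Definition is_cover (X : finType) (G H : {set {set X}}) : Prop :=
  forall A, A \in H -> exists2 B, B \in G & B \subset A.

Definition q_small (R : realType) (X : finType) (q : R) (H : {set {set X}}) :
    Prop :=
  exists2 G : {set {set X}},
    is_cover G H & \sum_(B in G) q ^+ #|B| <= 2^-1.

(* Main.v *)
(* Suppose that the family [H] of the theorem is not [q]-small, choose for every
   [A] in [H] a weight vector [lam A] with [lam A (A) > (1 + delta) E Z(X_p)],
   and let [2 ^ -m] be about [delta / 8]. Give every element of [X] one of [3m]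
   colours with probability [p / 3m] each, and no colour with probability
   [1 - p]: the coloured elements form [X_p], revealed in [3m] rounds. It is
   enough that with probability [>= 1 - 2 ^ -m] some [B] in [H] has all but a
   fraction [2 ^ (1 - m)] of its weight coloured.

   Order each [B] by decreasing [lam B] and cut it into prefixes (levels) of
   sizes [2 ^ (mj + 2m) - 1]; it suffices that fewer than [2 ^ (mj)] elements
   of the level [j] stay uncoloured, that is, that [2m] rounds halve the number
   of missing elements of every level. If no [B] achieves this for a set [S] of
   rounds, every [A] in [H] contains a fragment [T], made of the missing
   elements of some [B], frozen level by level at the first rounds at which [B]
   is late. Recolouring [T] with the colours of these rounds gives a colouring
   from which, as in the Park-Pham argument, [T] can be recovered up to
   [C ^ |T|] choices, because a fragment of minimal size lies inside a canonical
   competitor that only depends on the recoloured data. The fragments cover [H],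
   so their total cost exceeds [1/2]; as the recoloured configuration still
   fails for [S] minus the rounds used by [T], this yields by induction
   [P (failure for S) <= 2 ^ -(|S| - 2m)]. *)
Require Import Defs.
From mathcomp Require Import all_boot all_order all_algebra.
From mathcomp Require Import reals.
From mathcomp Require Import zify lra ring.

Set Implicit Arguments.
Unset Strict Implicit.
Unset Printing Implicit Defensive.

(** * Late levels, stairs, and the fragment of a failing colouring *)

Section Fragments.
Variables (X K : finType) (m J : nat).
Hypothesis m_gt0 : 0 < m.
Let N := 2 * m.
Variables (H : {set {set X}}) (r : {set X} -> X -> 'I_J).

(* [r B x] is the index of the first level of [B] that contains [x]. *)
Definition level (B : {set X}) (j : nat) := [set x in B | r B x <= j].
(* The level [j] is late at the round [i] (counted from 0) if at least
   [thr i j] of its elements are still missing after that round. *)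
Definition thr (i j : nat) := 2 ^ (m * j + (N - i.+1)).

(** The bound [2 ^ (m * j)] is the value of [thr] at the last round, [N.-1]. *)
Definition fail (S : {set K}) (t : {ffun X -> K}) :=
  [forall B in H, exists j : 'I_J,
     2 ^ (m * j) <= #|[set x in level B j | t x \notin S]|].

(* [s j] is the round at which the missing elements of the block [j] are frozen,
   [s j = N] meaning never. *)
Definition stairs := {ffun 'I_J -> 'I_N.+1}.
Definition monotone (s : stairs) := [forall j : 'I_J, forall k : 'I_J, (j <= k) ==> (s j <= s k)].
(** For a monotone [s], the last level of each group of levels frozen at a common round; the type
    ['I_N] leaves out the value [N]. *)
Definition corners (s : stairs) : {set 'I_N * 'I_J} :=
  [set c : 'I_N * 'I_J | (s c.2 == c.1 :> nat) && [forall k : 'I_J, (c.2 < k) ==> (c.1 < s k)]].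

Lemma monotoneP (s : stairs) : reflect (forall j k : 'I_J, j <= k -> s j <= s k) (monotone s).
Proof.
apply: (iffP forallP) => [h j k jk|h j]; last by apply/forallP=> k; apply/implyP/h.
by have /forallP/(_ k)/implyP/(_ jk) := h j.
Qed.

Lemma cornersP (s : stairs) (i : 'I_N) (j : 'I_J) :
  reflect (s j = i :> nat /\ forall k : 'I_J, j < k -> i < s k) ((i, j) \in corners s).
Proof.
rewrite inE /=; apply: (iffP andP) => -[h1 h2].
  split; first exact/eqP.
  by move=> k jk; have /forallP/(_ k)/implyP := h2; apply.
split; first exact/eqP.
by apply/forallP=> k; apply/implyP/h2.
Qed.

Lemma corner_ex (s : stairs) (j : 'I_J) : monotone s -> s j < N ->
  exists c, [/\ c \in corners s, j <= c.2 & c.1 = s j :> nat].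
Proof.
move=> /monotoneP ms sj.
case: (@arg_maxnP _ j (fun k => s k == s j) (fun k => nat_of_ord k)) => // k /eqP sk kmax.
exists (Ordinal sj, k); split=> //=; last by apply: kmax.
apply/cornersP; split; first by rewrite sk.
move=> l kl /=; have := ms _ _ (ltnW kl); rewrite sk leq_eqVlt => /orP[/eqP e|//].
by have := kmax l; rewrite -val_eqE /= e eqxx leqNgt kl => /(_ isT).
Qed.

(** [s j] is recovered as the round of the first corner at or beyond the level [j], and as [N] if
    there is none. *)
Lemma corners_inj : {in monotone &, injective corners}.
Proof.
have le (s s' : stairs) : monotone s -> monotone s' -> corners s = corners s' ->
    forall j, s' j <= s j.
  move=> ms ms' e j; case: (ltnP (s j) N) => [sj|]; last first.
    by move=> h; apply: leq_trans h; rewrite -ltnS.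
  have [[i k] [ck jk <-]] := corner_ex ms sj; move: ck; rewrite e => /cornersP[<- _].
  exact: (monotoneP _ ms').
move=> s s' ms ms' e; apply/ffunP=> j; apply/val_inj/eqP.
by rewrite eqn_leq !le.
Qed.

Lemma thr_gt0 i j : 0 < thr i j. Proof. by rewrite expn_gt0. Qed.

Hypothesis level_small : forall B (j : 'I_J), B \in H -> #|level B j| < 2 ^ (m * j + N).

Section Stage.
Variable D : seq K.
Hypothesis uniqD : uniq D.
Hypothesis sizeD : size D = N.

Definition profile := {ffun 'I_N -> 'I_#|X|.+1}.

(* [z] is a recoloured configuration, and [f i] stands for the number of
   elements that were given the colour of the round [i]. They are counted as
   missing for ever, so that compatibility does not depend on the colours that
   they had before. *)
Definition compatible (z : {ffun X -> K}) (s : stairs) (f : profile) (B : {set X}) :=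
  [&& B \in H, [forall x in B, index (z x) D <= s (r B x)] &
   [forall j : 'I_J, forall i : 'I_N, (i < s j) ==>
     (#|[set x in level B j | i < index (z x) D]| + \sum_(k : 'I_N | k <= i) f k < thr i j)]].

(** The competitor is picked from [z], [s] and [f] alone, so a fragment inside [ground] costs only a
    choice of subset. *)
Definition ground z s f : {set X} :=
  if [pick B | compatible z s f B] is Some B then
    [set x in B | (index (z x) D == s (r B x)) && (s (r B x) < N)] else set0.

(** These elements lie in the level [c.2] of the competitor and are missing before the round [c.1],
    when this level is not late yet; one round earlier the threshold is twice as large. At the round
    0 the bound is [level_small]. *)
Lemma ground_row z s f (c : 'I_N * 'I_J) : monotone s -> c \in corners s ->
  #|[set x in ground z s f | index (z x) D == c.1]| < 2 * thr c.1 c.2.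
Proof using level_small.
case: c => i j ms /= /cornersP[sj ck]; rewrite /ground; case: pickP => [B|_]; last first.
  by rewrite (_ : [set x in _ | _] = set0) ?cards0 ?muln_gt0 ?thr_gt0 //; apply/setP=> x; rewrite !inE.
case/and3P=> BH /forall_inP zs /forallP cmp.
have sub : [set x in [set x in B | (index (z x) D == s (r B x)) && (s (r B x) < N)] | index (z x) D == i]
    \subset [set x in level B j | i <= index (z x) D].
  apply/subsetP=> x; rewrite !inE => /andP[/and3P[-> /eqP e sN] /eqP e2].
  rewrite e2 leqnn andbT /= leqNgt; apply/negP=> /ck; rewrite -e e2 ltnn //.
apply: leq_ltn_trans (subset_leq_card sub) _.
have -> : 2 * thr i j = 2 ^ (m * j + (N - i)).
  by rewrite /thr -expnS -addnS subnSK.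
case ei : (nat_of_ord i) => [|i'].
  rewrite subn0; apply: leq_ltn_trans (level_small j BH); apply/subset_leq_card/subsetP=> x.
  by rewrite inE => /andP[].
have iN : i' < N by rewrite ltnW // -ei.
have /forallP/(_ (Ordinal iN)) := cmp j; rewrite /= sj ei ltnS leqnn /= => h.
by apply: leq_ltn_trans h; apply: leq_addr.
Qed.

Lemma ground_corner z s f x : monotone s -> x \in ground z s f ->
  exists2 c, c \in corners s & index (z x) D = c.1.
Proof.
rewrite /ground; case: pickP => [B _|_]; last by rewrite inE.
move=> ms; rewrite inE => /and3P[xB /eqP e /(corner_ex ms)[c [cs _ ec]]].
by exists c => //; rewrite ec.
Qed.

Lemma card_ground z s f : monotone s ->
  #|ground z s f| <= \sum_(c in corners s) 2 * thr c.1 c.2.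
Proof using level_small.
move=> ms.
apply: (@leq_trans (\sum_(c in corners s) #|[set x in ground z s f | index (z x) D == c.1]|)); last first.
  by apply: leq_sum => c cs; apply/ltnW/ground_row.
under [leqRHS]eq_bigr do rewrite -sum1_card.
rewrite (exchange_big_dep (mem (ground z s f))) /=; last by move=> c x _; rewrite inE => /andP[].
rewrite -sum1_card; apply: leq_sum => x xg.
have [c cs e] := ground_corner ms xg.
by rewrite (bigD1 c) ?cs ?inE ?xg ?e ?eqxx.
Qed.


Definition rows (s : stairs) : {set K} :=
  [set k in D | [exists c in corners s, index k D == c.1 :> nat]].

Lemma fragment (S : {set K}) (t : {ffun X -> K}) (A : {set X}) :
  {subset D <= S} -> fail S t -> A \in H ->
  exists T : {set X}, exists s : stairs, exists f : profile, exists z : {ffun X -> K},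
    [/\ T \subset A, [/\ monotone s, corners s != set0 &
          [forall c in corners s, thr c.1 c.2 <= #|T|]],
        [/\ [forall x, (x \notin T) ==> (t x == z x)],
            [forall x in T, z x \in D] & fail (S :\: rows s) z],
        T \subset ground z s f &
        [forall i, f i == #|[set x in T | index (z x) D == i]| :> nat]].
Proof.
move=> DS ft AH.
have N_gt0 : 0 < N by rewrite /N; lia.
have [k0 _] : exists k0, k0 \in D.
  by case: D sizeD => [/= e|k D' _]; [move: N_gt0; rewrite -e|exists k; rewrite mem_head].
(* A colour outside [D] has index [size D = N]: such an element is missing after all the rounds of
   [D]. *)
pose u x := index (t x) D.
have uN x : u x <= N by rewrite /u -sizeD index_size.
pose zt (b : {set X} * stairs) x := if x \in b.1 then minn (u x) (b.2 (r b.1 x)) else u x.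
pose Tt (b : {set X} * stairs) := [set x in b.1 | b.2 (r b.1 x) < u x].
(* [minn] stops the clock of a block at its freezing round, so the elements of [Tt b] stay missing
   for ever. *)
pose cnt (b : {set X} * stairs) i j := #|[set x in level b.1 j | minn i (b.2 (r b.1 x)) < u x]|.
pose valid b := [&& b.1 \in H, monotone b.2, Tt b \subset A &
  [forall j : 'I_J, forall i : 'I_N, (i < b.2 j) ==> (cnt b i j < thr i j)]].
pose Phi b := \sum_x (u x - zt b x) + \sum_j (N - b.2 j).
have valid0 : valid (A, [ffun=> ord0]).
  apply/and4P; split=> //=.
  - by apply/monotoneP=> j k _; rewrite !ffunE.
  - by apply/subsetP=> x; rewrite inE => /andP[].
  - by apply/forallP=> j; apply/forallP=> i; rewrite ffunE.
(* Minimality of [Phi] forbids to delay a corner of [s], and forces the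
   canonical competitor [B'] below to have the same frozen elements as [B]. *)
case: (arg_minnP Phi valid0) => -[B s] /and4P[/= BH ms TA /forallP cn] minB.
set b := (B, s) in TA minB *.
have ztu x : zt b x <= u x by rewrite /zt; case: ifP => // _; apply: geq_minl.
have TtE x : (x \in Tt b) = (zt b x < u x).
  rewrite inE /zt /=; case: ifP => /= [xB|]; last by rewrite ltnn.
  by rewrite gtn_min ltnn.
pose T := Tt b.
(* If nothing were frozen, no level of [B] would be late at the round [N.-1], against [ft]. *)
have sN : exists j, s j < N.
  have /forall_inP/(_ _ BH)/existsP[j hj] := ft.
  exists j; rewrite ltnNge; apply/negP=> sj.
  have hN : N.-1 < N by rewrite prednK.
  have /forallP/(_ (Ordinal hN))/implyP/= := cn j.
  have -> : N.-1 < s j by rewrite prednK.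
  move=> /(_ isT); rewrite ltnNge => /negP; apply.
  rewrite /thr prednK // subnn addn0; apply: leq_trans hj _.
  apply/subset_leq_card/subsetP=> x; rewrite !inE => /andP[-> xS] /=.
  rewrite gtn_min; apply/orP; left.
  rewrite prednK //; apply: contraNleq xS => h; apply: DS.
  by rewrite -index_mem sizeD.
(* Otherwise the corner can move to the next round: the missing elements of the level [j] at the
   round [i] all lie in [T], hence are too few to be late, and [Phi] drops. *)
have Tlarge : [forall c in corners s, thr c.1 c.2 <= #|T|].
  apply/forall_inP=> -[i j] /cornersP[sj sk] /=; rewrite leqNgt; apply/negP=> small.
  have iN : i.+1 < N.+1 by rewrite ltnS.
  pose s' : stairs := [ffun k => if k == j then Ordinal iN else s k].
  have ss' k : s k <= s' k by rewrite ffunE; case: eqP => // -> /=; rewrite sj.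
  have ztle x : zt b x <= zt (B, s') x.
    rewrite /zt /=; case: ifP => // _; rewrite leq_min geq_minl /=.
    by apply: leq_trans (ss' _); apply: geq_minr.
  have /minB : valid (B, s').
    apply/and4P; split=> //=.
    - apply/monotoneP=> k l kl; rewrite !ffunE.
      case: (k =P j) kl => [->|kj]; case: (l =P j) => [->|lj] //= kl.
      + by apply: sk; rewrite ltn_neqAle kl andbT; apply/eqP => /val_inj/esym.
      + by apply: leqW; rewrite -sj; apply: (monotoneP _ ms).
      + exact: (monotoneP _ ms).
    - apply: subset_trans TA; apply/subsetP=> x; rewrite !inE /= => /andP[->].
      exact: leq_ltn_trans.
    - apply/forallP=> j'; apply/forallP=> i'; apply/implyP=> h.
      case: (ltnP i' (s j')) => h'.
        have /forallP/(_ i')/implyP/(_ h') := cn j'; apply: leq_ltn_trans.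
        apply/subset_leq_card/subsetP=> x; rewrite !inE /= => /andP[->] /=.
        by apply: leq_ltn_trans; rewrite leq_min geq_minl /= (leq_trans (geq_minr _ _)).
      move: h h'; rewrite ffunE; case: eqP => [->|_] /=; last by move=> a /(leq_trans a); rewrite ltnn.
      rewrite ltnS sj => h h'; have {h h'}-> : i' = i by apply/val_inj/eqP; rewrite eqn_leq h h'.
      apply: leq_ltn_trans small; apply/subset_leq_card/subsetP=> x.
      rewrite !inE /= => /andP[/andP[-> xj]] /=; apply: leq_ltn_trans.
      by rewrite leq_min ss' andbT -sj; apply: (monotoneP _ ms).
  apply/negP; rewrite -ltnNge /Phi -addnS; apply: leq_add.
    by apply: leq_sum => x _; apply: leq_sub2l.
  rewrite (bigD1 j) //= [ltnRHS](bigD1 j) //= -addSn; apply: leq_add.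
    by rewrite ffunE eqxx /= sj; have := ltn_ord i; lia.
  by apply: leq_sum => k kj; apply: leq_sub2l.
have zN x : x \in T -> s (r B x) < N.
  by rewrite inE => /andP[_] /leq_trans; apply.
have zT x : x \in T -> zt b x = s (r B x).
  by rewrite inE /zt => /andP[/= -> h]; apply/minn_idPr/ltnW.
pose z : {ffun X -> K} := [ffun x => if x \in T then nth k0 D (s (r B x)) else t x].
have zE x : index (z x) D = zt b x.
  rewrite ffunE; case: ifP => xT; first by rewrite index_uniq ?zT ?sizeD ?zN.
  by apply/eqP; rewrite eqn_leq ztu andbT leqNgt -TtE; apply/negbT.
have fle i : #|[set x in T | index (z x) D == i]| < #|X|.+1 by rewrite ltnS max_card.
pose f : profile := [ffun i : 'I_N => Ordinal (fle i)].
have sumf (i : 'I_N) : \sum_(k : 'I_N | k <= i) f k = #|[set x in T | zt b x <= i]|.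
  rewrite (eq_bigr (fun k : 'I_N => \sum_(x in T | zt b x == k) 1)); last first.
    move=> k _; rewrite ffunE /= -sum1_card; apply: eq_bigl => x; rewrite inE zE //.
  rewrite -sum1_card (exchange_big_dep [pred x | x \in [set x in T | zt b x <= i]]) /=; last first.
    by move=> k x ki /andP[xT /eqP e]; rewrite inE xT e.
  apply: eq_bigr => x; rewrite inE => /andP[xT xi].
  have zxN : zt b x < N by rewrite zT ?zN.
  rewrite (big_pred1 (Ordinal zxN)) // => k.
  by rewrite /= xT /= -val_eqE /= eq_sym; case: eqP => [->|]; rewrite ?andbF // xi.
have BV : compatible z s f B.
  apply/and3P; split=> //.
    by apply/forall_inP=> x xB; rewrite zE /zt /= xB geq_minr.
  apply/forallP=> j; apply/forallP=> i; apply/implyP=> ij.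
  have /forallP/(_ i)/implyP/(_ ij) := cn j; apply: leq_ltn_trans; rewrite sumf.
  rewrite -cardsUI [X in _ + X](_ : _ = 0); last first.
    apply/eqP; rewrite cards_eq0; apply/eqP/setP=> x; rewrite !inE zE.
    by case: (leqP (zt b x) i); rewrite !andbF.
  rewrite addn0; apply/subset_leq_card/subsetP=> x; rewrite !inE zE /=.
  case/orP=> [/andP[/andP[xB ->]]|/andP[/andP[xB h]]].
    by rewrite /zt /= xB /= leq_min; case/andP=> iu _; rewrite gtn_min iu.
  rewrite /zt /= xB /= (minn_idPr (ltnW h)) => h2.
  rewrite gtn_min h orbT andbT leqNgt; apply/negP=> /ltnW/(monotoneP _ ms).
  by rewrite leqNgt (leq_ltn_trans h2).
exists T, s, f, z; split=> //.
- split=> //; have [j sj] := sN; have [c [cs _ _]] := corner_ex ms sj.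
  by apply/set0Pn; exists c.
- split.
  + by apply/forallP=> x; apply/implyP=> /negbTE xT; rewrite ffunE xT.
  + by apply/forall_inP=> x xT; rewrite -index_mem sizeD zE zT ?zN.
  + apply/forall_inP=> C CH; have /forall_inP/(_ _ CH)/existsP[j hj] := ft.
    apply/existsP; exists j; apply: leq_trans hj _; apply/subset_leq_card/subsetP=> x.
    rewrite !inE => /andP[->] /=; case: (boolP (x \in T)) => xT xS; last first.
      by rewrite ffunE (negbTE xT) (negbTE xS) andbF.
    rewrite -index_mem sizeD zE zT // zN //=.
    have [c [cs _ ec]] := corner_ex ms (zN _ xT).
    suff -> : [exists c in corners s, s (r B x) == c.1 :> nat] by [].
    by apply/existsP; exists c; rewrite cs ec eqxx.
- rewrite /ground; case: pickP => [B' /and3P[B'H /forall_inP z' /forallP c']|/(_ B)]; last first.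
    by rewrite BV.
  have TB' : Tt (B', s) \subset T.
    apply/subsetP=> x; rewrite [x \in T]TtE inE /= => /andP[xB].
    by apply: leq_ltn_trans; rewrite -zE z'.
  have ztle x : zt b x <= zt (B', s) x.
    by rewrite {2}/zt /=; case: ifP => // xB; rewrite leq_min ztu -zE z'.
  have /minB : valid (B', s).
    apply/and4P; split=> //=; first exact: subset_trans TA.
    apply/forallP=> j; apply/forallP=> i; apply/implyP=> ij.
    have /forallP/(_ i)/implyP/(_ ij) := c' j; apply: leq_ltn_trans; rewrite sumf.
    rewrite -cardsUI; apply: leq_trans (leq_addr _ _).
    apply/subset_leq_card/subsetP=> x; rewrite !inE -!zE /= => /andP[/andP[xB xj] h].
    rewrite xB xj /=; case: (ltnP i (index (z x) D)) => //= zi.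
    have : x \in T by rewrite TtE -zE; apply: leq_ltn_trans h; rewrite leq_min zi z'.
    by rewrite inE => ->.
  rewrite /Phi leq_add2r => le.
  (* [zt b] is pointwise below [zt (B', s)], so minimality forces equality. On [T], where
     [zt b x < u x], this puts [x] in [B'] with [z x] the colour of its freezing round. *)
  have eqz x : zt (B', s) x = zt b x.
    apply/eqP; rewrite eqn_leq ztle andbT leqNgt; apply/negP=> lt.
    move: le; apply/negP; rewrite -ltnNge (bigD1 x) //= [ltnRHS](bigD1 x) //=.
    rewrite -addSn; apply: leq_add; last by apply: leq_sum => y _; apply: leq_sub2l.
    apply: ltn_sub2l => //; apply: leq_trans lt _.
    by rewrite /zt; case: ifP => // _; apply: geq_minl.
  apply/subsetP=> x xT; rewrite inE zE.
  have := eqz x; have : zt b x < u x by rewrite -TtE.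
  have zxN : zt b x < N by rewrite zT ?zN.
  rewrite [zt (B', s) x]/zt /=; case: ifP => xB h e; last by rewrite -e ltnn in h.
  suff -> : s (r B' x) = zt b x :> nat by rewrite eqxx.
  by move: e h; rewrite /minn; case: ltnP => // _ <-; rewrite ltnn.
- by apply/forallP=> i; rewrite ffunE.
Qed.
End Stage.
End Fragments.

Import Order.TTheory GRing.Theory Num.Theory.

(** * Sums of thresholds and the number of profiles *)

Section Counting.
Variables (m J : nat).
Hypothesis m_gt0 : 0 < m.

Let expo (c : 'I_(2 * m) * 'I_J) := m * c.2 + (2 * m - c.1.+1).

(* As there are only [2m] rounds and the exponent grows by [m] from one level to
   the next, an exponent occurs at most twice; hence the thresholds at the
   corners add up to a bounded multiple of the largest one. *)
Lemma card_expo v : #|[set c | expo c == v]| <= 2.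
Proof.
apply: (@leq_trans #|{: bool}|); last by rewrite card_bool.
rewrite -(card_in_imset (f := fun c : 'I_(2 * m) * 'I_J => v %/ m == c.2 :> nat)) ?max_card //.
have key c : expo c = v -> v %/ m = c.2 + (2 * m - c.1.+1) %/ m /\ (2 * m - c.1.+1) %/ m < 2.
  by move=> <-; rewrite /expo mulnC divnMDl // ltn_divLR //; have := ltn_ord c.1; lia.
move=> [i j] [i' j']; rewrite !inE => /eqP e /eqP e' /=.
have [k k2] := key _ e; have [k' k2'] := key _ e'.
move: e e' k k' k2 k2' => /=; rewrite /expo /=.
move: (_ %/ m) (_ %/ m) (_ %/ m) => a b c e e' -> k' k2 k2' h.
have ej : j = j' :> nat by move: h; do 2!case: eqP; lia.
by congr (_, _); apply/val_inj => //=; have := ltn_ord i; have := ltn_ord i'; nia.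
Qed.

(** Each power occurs at most twice, and $2(1 + 2 + \dots + 2^v) < 4 \cdot 2^v$. *)
Lemma sum_expo v : \sum_(c | expo c <= v) 2 ^ expo c <= 4 * 2 ^ v.
Proof.
have eqv w : \sum_(c | expo c == w) 2 ^ expo c <= 2 * 2 ^ w.
  rewrite (eq_bigr (fun=> 2 ^ w)) => [|c /eqP -> //].
  by rewrite sum_nat_const leq_mul2r -cardsE card_expo orbT.
elim: v => [|v IH].
  rewrite (eq_bigl (fun c => expo c == 0)) => [|c]; last by rewrite leqn0.
  exact: leq_trans (eqv 0) _.
rewrite (bigID (fun c => expo c <= v)) /= expnS.
rewrite (eq_bigl (fun c => expo c <= v)); last by move=> c; case: ltngtP => //; lia.
rewrite [X in _ + X](eq_bigl (fun c => expo c == v.+1)); last by move=> c; lia.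
by apply: leq_trans (leq_add IH (eqv v.+1)) _; rewrite expnS; lia.
Qed.

Lemma sum_thr (C : {set 'I_(2 * m) * 'I_J}) t :
  (forall c, c \in C -> thr m c.1 c.2 <= t) -> \sum_(c in C) thr m c.1 c.2 <= 4 * t.
Proof.
move=> Ct; case: (set_0Vmem C) => [->|[c0 c0C]]; first by rewrite big_set0.
case: (@arg_maxnP _ c0 (mem C) expo c0C) => c1 c1C cmax.
apply: (@leq_trans (4 * thr m c1.1 c1.2)); last by rewrite leq_mul2l Ct.
apply: leq_trans (sum_expo _); rewrite big_mkcond [leqRHS]big_mkcond /=.
by apply: leq_sum => c _; case: ifP => // cC; have -> : expo c <= expo c1 := cmax c cC.
Qed.

Variable X : finType.

(** The constraints that [ground_row] and [ground_corner] put on the colour counts of a fragment. *)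
Definition small_profile (s : stairs m J) (f : profile X m) :=
  [forall c in corners s, f c.1 < 2 * thr m c.1 c.2] &&
  [forall i, [exists c in corners s, i == c.1] || (f i == 0 :> nat)].

Lemma card_small_profile s :
  #|[set f | small_profile s f]| <= \prod_(c in corners s) (2 * thr m c.1 c.2).
Proof.
(* On a row without corner the product is empty, and [f i < 1] says that [f i] vanishes. *)
pose bd (i : 'I_(2 * m)) := \prod_(c in corners s | c.1 == i) (2 * thr m c.1 c.2).
rewrite (partition_big (fun c => c.1) predT) //= -/bd.
have prod_gt0 (P : pred ('I_(2 * m) * 'I_J)) : 0 < \prod_(c | P c) (2 * thr m c.1 c.2).
  by apply: prodn_cond_gt0 => c _; rewrite muln_gt0 thr_gt0.
apply: (@leq_trans #|[set f : profile X m | [forall i, f i < bd i]]|).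
  apply/subset_leq_card/subsetP=> f; rewrite !inE => /andP[/forall_inP h1 /forallP h2].
  apply/forallP=> i; case/orP: (h2 i) => [/exists_inP[c cs /eqP ->]|/eqP ->]; last exact: prod_gt0.
  apply: leq_trans (h1 c cs) _; rewrite /bd (bigD1 c) ?cs ?eqxx //=.
  exact/leq_pmulr/prod_gt0.
rewrite -sum1_card.
rewrite (eq_bigl (fun f : profile X m => f \in family (fun i => [pred k : 'I_#|X|.+1 | k < bd i]))); last first.
  by move=> f; rewrite inE; apply/forallP/familyP => h i; have := h i; rewrite inE.
rewrite (eq_bigr (fun f : profile X m => \prod_(i : 'I_(2 * m)) 1)); last first.
  by move=> f _; rewrite big1.
rewrite -(bigA_distr_big_dep _ (fun _ _ => 1)) /=; apply: leq_prod => i _.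
case: (leqP (bd i) #|X|.+1) => h.
  by rewrite -(big_ord_widen _ (fun=> 1) h) sum1_card card_ord.
by rewrite sum1_card (leq_trans (max_card _)) // card_ord ltnW.
Qed.

End Counting.

Local Open Scope ring_scope.

(** * Convergence of the sum over all stairs *)

Section Stairs_series.
Variable R : realFieldType.

Lemma prod1D_le (I : Type) (l : seq I) (a : I -> R) : (forall i, 0 <= a i) ->
  \prod_(i <- l) (1 + a i) * (1 - \sum_(i <- l) a i) <= 1.
Proof.
move=> a0; elim: l => [|i l IH]; first by rewrite !big_nil; lra.
rewrite !big_cons; apply: le_trans IH.
have P0 : 0 <= \prod_(j <- l) (1 + a j) by apply: prodr_ge0 => j _; have := a0 j; lra.
have s0 : 0 <= \sum_(j <- l) a j by apply: sumr_ge0.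
rewrite mulrAC mulrC ler_wpM2l //; have := a0 i; nra.
Qed.

Lemma geometric_le n : \sum_(i < n) 8^-1 ^+ i <= 8 / 7 :> R.
Proof.
have := subrX1 (8^-1 : R) n; have : 0 <= 8^-1 ^+ n :> R by apply: exprn_ge0; lra.
lra.
Qed.

Variables m J : nat.
Hypothesis m_gt0 : (0 < m)%N.

(** Since $2^e > e$, the sum is at most $1/8$ times two geometric series, that is $\frac18
    (\frac87)^2 < \frac13$. *)
Lemma sum_thr_pow : \sum_(c : 'I_(2 * m) * 'I_J) 8^-1 ^+ thr m c.1 c.2 <= 3^-1 :> R.
Proof.
have e8 : 0 <= (8^-1 : R) by lra.
 have e9 : (8^-1 : R) <= 1 by lra.
apply: (@le_trans _ _ (\sum_(c : 'I_(2 * m) * 'I_J) 8^-1 * 8^-1 ^+ (rev_ord c.1) * 8^-1 ^+ c.2)).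
  apply: ler_sum => c _; rewrite -exprS -exprD ler_wiXn2l //.
  rewrite /thr /=; apply: leq_trans (ltn_expl _ (isT : (1 < 2)%N)).
  by rewrite addSn ltnS addnC leq_add2r; nia.
rewrite -(pair_big xpredT xpredT (fun i j => 8^-1 * 8^-1 ^+ (rev_ord i) * 8^-1 ^+ (nat_of_ord j))) /=.
under eq_bigr do rewrite -mulr_sumr.
rewrite -mulr_suml -mulr_sumr.
have -> : \sum_(i < 2 * m) 8^-1 ^+ (2 * m - i.+1) = \sum_(i < 2 * m) 8^-1 ^+ i :> R.
  by rewrite [RHS](reindex_inj rev_ord_inj).
have := geometric_le (2 * m); have := geometric_le J.
have : 0 <= \sum_(i < J) 8^-1 ^+ i :> R by apply: sumr_ge0 => i _; apply: exprn_ge0; lra.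
have : 0 <= \sum_(i < 2 * m) 8^-1 ^+ i :> R by apply: sumr_ge0 => i _; apply: exprn_ge0; lra.
by nra.
Qed.

(** By [corners_inj] the sum is at most the one over all nonempty sets of cells, which is $\prod_c
    (1 + y_c) - 1$. By [prod1D_le] this is at most $\sigma / (1 - \sigma)$ with $\sigma = \sum_c y_c
    \le 1/3$. *)
Lemma sum_stairs :
  \sum_(s : stairs m J | monotone s && (corners s != set0))
    8^-1 ^+ (\sum_(c in corners s) thr m c.1 c.2) <= 2^-1 :> R.
Proof.
pose y (c : 'I_(2 * m) * 'I_J) : R := 8^-1 ^+ thr m c.1 c.2.
have y0 c : 0 <= y c by apply: exprn_ge0; lra.
rewrite (eq_bigr (fun s => \prod_(c in corners s) y c)); last first.
  by move=> s _; rewrite expr_sum.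
have : \sum_(C : {set 'I_(2 * m) * 'I_J} | C != set0) \prod_(c in C) y c <= 2^-1.
  have := prod1D_le (index_enum _) y0; have := sum_thr_pow; rewrite -/y.
  under [in X in _ -> X -> _]eq_bigr do rewrite addrC.
  rewrite bigA_distr /= (bigD1 set0) //= [X in (X + _) * _]big1 => [|c _]; last by rewrite in_set0.
  rewrite (eq_bigr (fun C : {set _} => \prod_(c in C) y c)); last first.
    by move=> C _; rewrite [RHS]big_mkcond.
  have : 0 <= \sum_(C : {set 'I_(2 * m) * 'I_J} | C != set0) \prod_(c in C) y c.
    by apply: sumr_ge0 => C _; apply: prodr_ge0.
  by nra.
apply: le_trans; rewrite -(big_imset (fun C : {set _} => \prod_(c in C) y c)) /=; last first.
  by move=> s s' /andP[ms _] /andP[ms' _]; apply: corners_inj.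
rewrite big_mkcond [leRHS]big_mkcond; apply: ler_sum => C _.
case: ifP => [/imsetP[s /andP[_ sn] ->]|_]; first by rewrite sn.
by case: ifP => // _; apply: prodr_ge0.
Qed.
End Stairs_series.

(** * Independent random colourings *)

Section Colouring.
Variables (R : realFieldType) (X K : finType) (w : K -> R).
Hypotheses (w_ge0 : forall k, 0 <= w k) (w_sum : \sum_k w k = 1).

Definition colouring_pmf (t : {ffun X -> K}) := \prod_x w (t x).

Lemma colouring_pmf_ge0 t : 0 <= colouring_pmf t.
Proof. exact: prodr_ge0. Qed.

Lemma colouring_pmf_family (F : X -> pred K) :
  \sum_(t in family F) colouring_pmf t = \prod_x \sum_(k | F x k) w k.
Proof. by rewrite (bigA_distr_big_dep _ (fun _ k => w k)). Qed.

Lemma colouring_pmf_sum (P : pred {ffun X -> K}) : \sum_(t | P t) colouring_pmf t <= 1.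
Proof.
have <- : \sum_t colouring_pmf t = 1.
  by rewrite -(bigA_distr_bigA (fun _ k => w k)) big1.
rewrite big_mkcond; apply: ler_sum => t _; case: ifP => // _; exact: colouring_pmf_ge0.
Qed.

(** On [T] the colours of [t] are free and have total mass 1, whereas each colour of [z] there has
    mass [a]. *)
Lemma recolour (z : {ffun X -> K}) (T : {set X}) (a : R) :
  (forall x, x \in T -> w (z x) = a) ->
  (\sum_(t : {ffun X -> K} | [forall x, (x \notin T) ==> (t x == z x)]) colouring_pmf t) * a ^+ #|T|
    = colouring_pmf z.
Proof.
move=> za.
rewrite (eq_bigl (fun t => t \in family (fun x => [pred k | (x \in T) || (k == z x)]))); last first.
  move=> t; apply/forallP/familyP => h x; have := h x; rewrite inE /=; by case: (x \in T).
rewrite colouring_pmf_family -prodr_const [X in _ * X]big_mkcond -big_split /=.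
apply: eq_bigr => x _; case: ifP => xT /=; first by rewrite w_sum mul1r za.
by rewrite mulr1 (big_pred1 (z x)).
Qed.
End Colouring.

(** * The recursive bound on the failure probability *)

Section Recursion.
Variables (R : realFieldType) (X K : finType) (w : K -> R).
Hypotheses (w_ge0 : forall k, 0 <= w k) (w_sum : \sum_k w k = 1).
Variables (m J : nat).
Hypothesis m_gt0 : (0 < m)%N.
Variables (H : {set {set X}}) (r : {set X} -> X -> 'I_J).
Hypothesis level_small :
  forall B (j : 'I_J), B \in H -> (#|level r B j| < 2 ^ (m * j + 2 * m))%N.
Variables (q a th : R) (S0 : {set K}).
Hypotheses (a_gt0 : 0 < a) (w_S0 : forall k, k \in S0 -> w k = a).
(* Arithmetic decision procedures are slow on [256^-1 ^+ 4], hence the name. *)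
Hypotheses (th_eq : th = 256^-1) (q_ge0 : 0 <= q) (q_le : q <= a * th ^+ 4).
Hypothesis cover_cost : forall G : {set {set X}},
  (forall A, A \in H -> exists2 B, B \in G & B \subset A) ->
  2^-1 < \sum_(B in G) q ^+ #|B|.

Let weight (s : stairs m J) := (\sum_(c in corners s) thr m c.1 c.2)%N.

Lemma leq_corners_weight s : (#|corners s| <= weight s)%N.
Proof. by rewrite -sum1_card; apply: leq_sum => c _; apply: thr_gt0. Qed.

Lemma card_rows (D : seq K) (s : stairs m J) : (#|rows D s| <= #|corners s|)%N.
Proof.
have [->|[k0 _]] := set_0Vmem (rows D s); first by rewrite cards0.
apply: leq_trans (leq_imset_card (fun c : 'I_(2 * m) * 'I_J => nth k0 D c.1) (corners s)).
apply/subset_leq_card/subsetP=> k; rewrite inE => /andP[kD /exists_inP[c cs /eqP e]].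
by apply/imsetP; exists c; rewrite // -e nth_index.
Qed.

Lemma card_setD_rows (S : {set K}) (D : seq K) (s : stairs m J) :
  {subset D <= S} -> uniq D -> size D = (2 * m)%N -> corners s != set0 ->
  (#|S :\: rows D s| < #|S|)%N.
Proof.
move=> DS uD sD /set0Pn[c cs]; apply/proper_card/properP; split; first exact: subsetDl.
have cD : (c.1 < size D)%N by rewrite sD.
have [k0 _] : exists k0, k0 \in D.
  by case: (D) cD => // k D' _; exists k; rewrite mem_head.
exists (nth k0 D c.1); first by apply/DS/mem_nth.
rewrite !inE mem_nth //= negb_and negbK; apply/orP; left.
by apply/exists_inP; exists c; rewrite ?index_uniq.
Qed.

(* A double count of the pairs (failing colouring, fragment) through the
   recoloured configuration [z], which fails for the rounds left over. *)
Lemma fail_step (S : {set K}) (D : seq K) (b : R) :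
  0 <= b -> S \subset S0 -> {subset D <= S} -> uniq D -> size D = (2 * m)%N ->
  (forall s, corners s != set0 ->
    \sum_(t | fail m H r (S :\: rows D s) t) colouring_pmf w t <= b * 2 ^+ weight s) ->
  \sum_(t | fail m H r S t) colouring_pmf w t <= b.
Proof.
move=> b0 SS0 DS uD sD IH.
pose agree (T : {set X}) (z t : {ffun X -> K}) := [forall x, (x \notin T) ==> (t x == z x)].
pose base (p : stairs m J * profile X m * {ffun X -> K}) (T : {set X}) :=
  let: (s, f, z) := p in
  [&& monotone s && (corners s != set0), [forall c in corners s, (thr m c.1 c.2 <= #|T|)%N],
    [forall x in T, z x \in D], fail m H r (S :\: rows D s) z & (T \subset ground H r D z s f) &&
    [forall i, f i == #|[set x in T | index (z x) D == i]| :> nat]].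
have th0 : 0 <= th by rewrite th_eq invr_ge0 ler0n.
have mu0 t : 0 <= colouring_pmf w t by apply: colouring_pmf_ge0.
have cost t : fail m H r S t ->
    2^-1 <= \sum_T \sum_(p | base p T && agree T p.2 t) q ^+ #|T|.
  move=> ft; pose U := [set T | [exists p, base p T && agree T p.2 t]].
  have /cover_cost/ltW : forall A, A \in H -> exists2 B, B \in U & B \subset A.
    move=> A AH; have [T [s [f [z [TA [ms cs Tge] [ag zD fz] Tg fE]]]]] :=
      fragment m_gt0 uD sD DS ft AH.
    exists T => //; rewrite inE; apply/existsP; exists (s, f, z); apply/andP; split=> //.
    by apply/and5P; rewrite ms; split=> //; apply/andP.
  move=> h; apply: le_trans h _; rewrite big_mkcond; apply: ler_sum => T _.
  case: ifP => [|_]; last by apply: sumr_ge0 => *; apply: exprn_ge0.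
  rewrite inE => /existsP[p hp]; rewrite (bigD1 p) //= lerDl.
  by apply: sumr_ge0 => *; apply: exprn_ge0.
have step1 : 2^-1 * \sum_(t | fail m H r S t) colouring_pmf w t <=
    \sum_p \sum_(T | base p T) q ^+ #|T| * \sum_(t | agree T p.2 t) colouring_pmf w t.
  apply: (@le_trans _ _ (\sum_t \sum_T \sum_(p | base p T && agree T p.2 t) q ^+ #|T| * colouring_pmf w t)).
    rewrite mulr_sumr big_mkcond; apply: ler_sum => t _; case: ifP => [ft|_].
      under eq_bigr do rewrite -mulr_suml; rewrite -mulr_suml ler_wpM2r //; exact: cost.
    by apply: sumr_ge0 => T _; apply: sumr_ge0 => p _; rewrite mulr_ge0 ?exprn_ge0.
  rewrite exchange_big /=.
  rewrite (eq_bigr (fun T => \sum_(p | base p T) \sum_(t | agree T p.2 t) q ^+ #|T| * colouring_pmf w t)); last first.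
    move=> T _; rewrite (exchange_big_dep (fun p => base p T)) /=; last by move=> t p _ /andP[].
    by apply: eq_bigr => p bp; apply: eq_bigl => t; rewrite bp.
  rewrite (exchange_big_dep predT) //=; apply: ler_sum => p _; apply: ler_sum => T _.
  by rewrite mulr_sumr.
(* The factor [a] in the bound on [q] pays for the recolouring. By [sum_thr],
   [weight s <= 4 * #|T|], so the factor [th ^+ 4] per element of [T] is at most [th ^+ weight s] in
   all. *)
have step2 : 2^-1 * \sum_(t | fail m H r S t) colouring_pmf w t <=
   \sum_(s : stairs m J | monotone s && (corners s != set0)) \sum_(f | small_profile s f)
    \sum_(z | fail m H r (S :\: rows D s) z) \sum_(T in powerset (ground H r D z s f))
      colouring_pmf w z * th ^+ weight s.
  apply: le_trans step1 _.
  have -> : \sum_p \sum_(T | base p T)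
        q ^+ #|T| * \sum_(t | agree T p.2 t) colouring_pmf w t =
      \sum_s \sum_f \sum_z \sum_(T | base (s, f, z) T)
        q ^+ #|T| * \sum_(t | agree T z t) colouring_pmf w t.
    by rewrite pair_bigA /= pair_bigA; apply: eq_bigr => -[[s f] z].
  have pos s z : 0 <= colouring_pmf w z * th ^+ weight s.
    by rewrite mulr_ge0 // exprn_ge0.
  have nul (s : stairs m J) f z : ~~ [&& monotone s && (corners s != set0), small_profile s f & fail m H r (S :\: rows D s) z] ->
    \sum_(T | base (s, f, z) T) q ^+ #|T| * \sum_(t | agree T z t) colouring_pmf w t = 0.
    move=> h; rewrite big_pred0 // => T; apply/negP; case/and5P=> ms _ zD fz /andP[Tg /forallP fE].
    move: h; rewrite ms fz andbT /= => /negP; apply; case/andP: ms => ms _.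
    apply/andP; split.
      apply/forall_inP=> c cs; rewrite (eqP (fE _)); apply: leq_ltn_trans (ground_row level_small D z f ms cs).
      by apply/subset_leq_card/subsetP=> x; rewrite !inE => /andP[/(subsetP Tg) -> ->].
    apply/forallP=> i; case: (posnP (f i)) => [_|]; first by rewrite orbT.
    rewrite (eqP (fE _)) card_gt0 => /set0Pn[x]; rewrite inE => /andP[/(subsetP Tg) xg /eqP xi].
    have [c cs e] := ground_corner ms xg.
    by apply/orP; left; apply/exists_inP; exists c; rewrite // -val_eqE /= -xi e.
  rewrite [leRHS]big_mkcond; apply: ler_sum => s _.
  case: ifP => hs; last first.
    by rewrite big1 // => f _; rewrite big1 // => z _; rewrite nul // hs.
  rewrite [leRHS]big_mkcond; apply: ler_sum => f _.
  case: ifP => hf; last by rewrite big1 // => z _; rewrite nul // hs hf.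
  rewrite [leRHS]big_mkcond; apply: ler_sum => z _.
  case: ifP => hz; last by rewrite nul // hs hf hz.
  rewrite big_mkcond [leRHS]big_mkcond; apply: ler_sum => T _.
  case: ifP => hT; last by case: ifP.
  case/and5P: hT => _ /forall_inP Tge /forall_inP zD _ /andP[Tg _].
  rewrite powersetE Tg.
  have <- := @recolour R X K w w_sum z T a; last first.
    by move=> x xT; apply/w_S0/(subsetP SS0)/DS/zD.
  rewrite mulrC -mulrA; apply: ler_wpM2l; first by apply: sumr_ge0.
  apply: (@le_trans _ _ ((a * th ^+ 4) ^+ #|T|)); first by rewrite lerXn2r // nnegrE // (le_trans q_ge0).
  rewrite exprMn -exprM; apply: ler_wpM2l; first by rewrite exprn_ge0 // ltW.
  by rewrite ler_wiXn2l ?(sum_thr m_gt0) // th_eq invf_le1 ?ler1n.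
(* With $w$ the weight of [s], $256^{-w}$ is set against $4^w$ sets [T], $4^w$ profiles and the
   factor $2^w$ of [IH], which leaves $8^{-w}$. *)
have step3 : 2^-1 * \sum_(t | fail m H r S t) colouring_pmf w t <=
   \sum_(s : stairs m J | monotone s && (corners s != set0)) b * 8^-1 ^+ weight s.
  apply: le_trans step2 _; apply: ler_sum => s /andP[ms cs].
  have four : \sum_(c in corners s) 2 * thr m c.1 c.2 = (2 * weight s)%N by rewrite -big_distrr.
  apply: (@le_trans _ _ (\sum_(f | small_profile s f) \sum_(z | fail m H r (S :\: rows D s) z)
      colouring_pmf w z * 64^-1 ^+ weight s)).
    apply: ler_sum => f _; apply: ler_sum => z _.
    rewrite sumr_const card_powerset -[leLHS]mulr_natr -mulrA; apply: ler_wpM2l => //.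
    have : (2 ^ #|ground H r D z s f| <= 4 ^ weight s)%N.
      by rewrite -[4%N]/(2 ^ 2)%N -expnM leq_exp2l // -four (card_ground level_small).
    rewrite -(ler_nat R) natrX => h.
    apply: (@le_trans _ _ (th ^+ weight s * (4 ^ weight s)%:R)).
      by rewrite ler_wpM2l ?exprn_ge0.
    by rewrite natrX -exprMn (_ : th * 4 = 64^-1) // th_eq (natrM _ 64 4) invfM mulfVK // pnatr_eq0.
  under eq_bigr do rewrite -mulr_suml; rewrite sumr_const -[leLHS]mulr_natr.
  have h1 := IH s cs.
  have : (#|[set f : profile X m | small_profile s f]| <= 4 ^ weight s)%N.
    apply: leq_trans (card_small_profile X s) _.
    rewrite /weight expn_sum; apply: leq_prod => c _.
    apply: (@leq_trans (2 ^ thr m c.1 c.2 * 2 ^ thr m c.1 c.2)); last by rewrite -expnMn.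
    by apply: leq_mul; [rewrite -{1}[2%N]expn1 leq_exp2l // thr_gt0 | exact/ltnW/ltn_expl].
  rewrite cardsE -(ler_nat R) natrX => h2.
  have e : b * 2 ^+ weight s * 64^-1 ^+ weight s * 4 ^+ weight s = b * 8^-1 ^+ weight s.
    by rewrite -!mulrA -!exprMn (_ : 2 * (64^-1 * 4) = 8^-1) //; field.
  rewrite -e; apply: ler_pM => //.
    by apply: mulr_ge0; [apply: sumr_ge0|apply: exprn_ge0; rewrite invr_ge0 ler0n].
  by apply: ler_wpM2r => //; apply: exprn_ge0; rewrite invr_ge0 ler0n.
have : 2^-1 * \sum_(t | fail m H r S t) colouring_pmf w t <= b * 2^-1.
  by apply: le_trans step3 _; rewrite -mulr_sumr; apply: ler_wpM2l (sum_stairs _ _ m_gt0).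
lra.
Qed.

Lemma fail_prob (S : {set K}) : S \subset S0 ->
  \sum_(t | fail m H r S t) colouring_pmf w t <= 2^-1 ^+ (#|S| - 2 * m).
Proof.
have [k] := ubnP #|S|; elim: k => // k IH in S *; rewrite ltnS => Sk SS0.
case: (leqP #|S| (2 * m)) => Sm.
  by rewrite (eqP Sm) expr0; apply: colouring_pmf_sum.
pose D := take (2 * m) (enum S).
have DS : {subset D <= S} by move=> x /mem_take; rewrite mem_enum.
have uD : uniq D by apply/take_uniq/enum_uniq.
have sD : size D = (2 * m)%N by rewrite size_takel // -cardE ltnW.
apply: (fail_step _ SS0 DS uD sD); first by rewrite exprn_ge0 //; lra.
move=> s cs; have lt := card_setD_rows DS uD sD cs.
apply: le_trans (IH _ _ _) _; first exact: leq_trans lt Sk.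
  exact: subset_trans (subsetDl _ _) SS0.
(* At most one round is lost per corner and each corner weighs at least 1, so the loss fits in the
   factor $2^{w}$ that [fail_step] allows. *)
have : (#|S| - 2 * m <= #|S :\: rows D s| - 2 * m + weight s)%N.
  have := cardsID (rows D s) S; have := subset_leq_card (subsetIr S (rows D s)).
  have := card_rows D s; have := leq_corners_weight s; lia.
move=> /(@ler_wiXn2l R 2^-1) h.
apply: (@le_trans _ _ (2^-1 ^+ (#|S :\: rows D s| - 2 * m + weight s) * 2 ^+ weight s)).
  by rewrite exprD -mulrA -exprMn mulVf ?expr1n ?mulr1 ?pnatr_eq0.
by apply: ler_wpM2r; [exact: exprn_ge0|apply: h; lra].
Qed.
End Recursion.

(** * Levels by decreasing weight, and the weight of the missing elements *)

Section Ranking.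
Variables (R : realFieldType) (X : finType) (m : nat).
Hypothesis m_gt0 : (0 < m)%N.
Variable lam : {set X} -> X -> R.
Hypothesis lam_ge0 : forall A x, 0 <= lam A x.

Definition ranking (B : {set X}) := sort (fun x y => lam B y <= lam B x) (enum B).

(** The strict inequality gives prefixes of $2^{mj+2m} - 1$ elements; the default [ord_max]
    qualifies for every [x] in [B], as its prefix is longer than [X]. *)
Definition rank_level (B : {set X}) (x : X) : 'I_#|X|.+1 :=
  [arg min_(j < ord_max | ((index x (ranking B)).+1 < 2 ^ (m * j + 2 * m))%N) nat_of_ord j].

Lemma ranking_uniq B : uniq (ranking B).
Proof. by rewrite sort_uniq enum_uniq. Qed.

Lemma mem_ranking (B : {set X}) x : (x \in ranking B) = (x \in B).
Proof. by rewrite mem_sort mem_enum. Qed.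

Lemma rank_levelE (B : {set X}) x j : x \in B ->
  (rank_level B x <= j)%N = ((index x (ranking B)).+1 < 2 ^ (m * j + 2 * m))%N.
Proof.
move=> xB; rewrite /rank_level; case: arg_minnP => [|i hi imin].
  apply: (@leq_ltn_trans #|X|).
    apply: (@leq_trans (size (ranking B))); first by rewrite index_mem mem_ranking.
    by rewrite -(card_uniqP (ranking_uniq B)) max_card.
  by apply: leq_trans (ltn_expl _ (isT : (1 < 2)%N)) _; rewrite leq_exp2l //=; nia.
apply/idP/idP => [ij|h].
  by apply: leq_trans hi _; rewrite leq_exp2l // leq_add2r leq_mul2l ij orbT.
case: (ltnP j #|X|.+1) => jX; first exact: (imin (Ordinal jX)).
by apply: leq_trans jX; rewrite ltnW.
Qed.

Lemma card_rank_level (B : {set X}) j : (#|level rank_level B j| < 2 ^ (m * j + 2 * m))%N.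
Proof.
have lt0 : (0 < 2 ^ (m * j + 2 * m))%N by rewrite expn_gt0.
rewrite -(prednK lt0) ltnS.
apply: (@leq_trans #|take (2 ^ (m * j + 2 * m)).-1 (ranking B)|).
  apply/subset_leq_card/subsetP=> x; rewrite inE => /andP[xB].
  rewrite rank_levelE // => h; rewrite in_take ?mem_ranking //.
  by rewrite -ltnS prednK.
by apply: leq_trans (card_size _) _; rewrite size_take_min geq_minl.
Qed.

(* The upper half of the block of level [j] consists of [2 ^ (mj + 2m - 1)]
   elements ranked before [x]. *)
Lemma block_weight (B : {set X}) x j : x \in B -> rank_level B x = j.+1 :> nat ->
  2 ^+ (m * j + 2 * m).-1 * lam B x <= \sum_(y in B | rank_level B y == j :> nat) lam B y.
Proof.
move=> xB rx; set e := (m * j + 2 * m)%N; set s := ranking B.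
have e_gt0 : (0 < e)%N by rewrite /e; lia.
have ix : (2 ^ e <= (index x s).+1)%N by rewrite leqNgt -rank_levelE // rx ltnn.
have xs : (index x s < size s)%N by rewrite index_mem mem_ranking.
have half : (2 ^ e = 2 ^ e.-1 + 2 ^ e.-1)%N by rewrite -{1}(prednK e_gt0) expnS mul2n addnn.
have h_gt0 : (0 < 2 ^ e.-1)%N by rewrite expn_gt0.
(* The positions from $2^{e-1} - 1$ to $2^e - 2$ end the prefix of the level [j] and lie beyond the
   previous prefix, because [m] is positive. *)
pose a := (2 ^ e.-1).-1; pose l := [seq nth x s i | i <- iota a (2 ^ e.-1)].
have il i : i \in iota a (2 ^ e.-1) -> [&& (i < index x s)%N, (a <= i)%N & (i.+1 < 2 ^ e)%N].
  by rewrite mem_iota /a => /andP[h1 h2]; apply/and3P; split; lia.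
have ul : uniq l.
  rewrite map_inj_in_uniq ?iota_uniq // => i k /il/and3P[hi _ _] /il/and3P[hk _ _] /eqP.
  by rewrite nth_uniq ?ranking_uniq //; [move/eqP|exact: ltn_trans xs|exact: ltn_trans xs].
apply: (@le_trans _ _ (\sum_(y <- l) lam B y)).
  rewrite big_map (_ : 2 ^+ _ * _ = \sum_(i <- iota a (2 ^ e.-1)) lam B x); last first.
    by rewrite big_const_seq count_predT size_iota iter_addr_0 -[RHS]mulr_natl natrX.
  rewrite big_seq [leRHS]big_seq; apply: ler_sum => i /il/and3P[hi _ _].
  rewrite -{1}(nth_index x (_ : x \in s)); last by rewrite mem_ranking.
  apply: (@sorted_leq_nth _ (fun x y => lam B y <= lam B x)).
  - by move=> u v t h1 h2; apply: le_trans h1.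
  - by move=> u; apply: lexx.
  - by apply: sort_sorted => u v; apply: le_total.
  - by rewrite inE; apply: ltn_trans xs.
  - by rewrite inE.
  - exact: ltnW.
rewrite big_uniq //= big_mkcond [leRHS]big_mkcond; apply: ler_sum => y _.
case: ifP => [/mapP[i /il/and3P[hi ai iN] ->]|_]; last by case: ifP.
have is_ : (i < size s)%N by apply: ltn_trans xs.
have yB : nth x s i \in B by rewrite -mem_ranking mem_nth.
suff -> : rank_level B (nth x s i) == j :> nat by rewrite yB.
rewrite eqn_leq rank_levelE // index_uniq ?ranking_uniq // iN /=.
case: j @e ix e_gt0 half h_gt0 @a @l ai {il ul rx hi iN} => // j e ix e_gt0 half h_gt0 a l ai.
rewrite ltnNge rank_levelE // index_uniq ?ranking_uniq // -leqNgt.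
apply: (@leq_trans (2 ^ e.-1)); first by rewrite leq_exp2l // /e; nia.
by move: ai; rewrite /a; lia.
Qed.

(** The level 0 misses nothing. Fewer than $2^{m(j+1)}$ elements of the block $j+1$ are missing,
    each of weight at most $2^{-(mj+2m-1)}$ times that of the block $j$: a ratio of $2^{1-m}$. *)
Lemma missing_weight (B M : {set X}) : M \subset B ->
  (forall j : 'I_#|X|.+1, (#|[set x in level rank_level B j | x \in M]| < 2 ^ (m * j))%N) ->
  2 ^+ m * \sum_(x in M) lam B x <= 2 * \sum_(x in B) lam B x.
Proof.
move=> MB Msmall.
have step (j : nat) : (j.+1 < #|X|.+1)%N ->
    2 ^+ m * \sum_(x in M | rank_level B x == j.+1 :> nat) lam B x <=
    2 * \sum_(x in B | rank_level B x == j :> nat) lam B x.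
  move=> jX; set W := \sum_(x in B | _) _.
  have W0 : 0 <= W by apply: sumr_ge0.
  set e := (m * j + 2 * m).-1.
  have e2 : (e.+1 = m * j.+1 + m)%N by rewrite /e; lia.
  have pos k : 0 < 2 ^+ k :> R by rewrite exprn_gt0.
  have le1 : 2 ^+ e * \sum_(x in M | rank_level B x == j.+1 :> nat) lam B x <= 2 ^+ (m * j.+1) * W.
    rewrite mulr_sumr; apply: (@le_trans _ _ (\sum_(x in M | rank_level B x == j.+1 :> nat) W)).
      by apply: ler_sum => x /andP[xM /eqP rx]; apply: block_weight; rewrite // (subsetP MB).
    rewrite sumr_const -[leLHS]mulr_natl; apply: ler_wpM2r => //.
    rewrite -natrX ler_nat; apply: leq_trans (ltnW (Msmall (Ordinal jX))).
    apply/subset_leq_card/subsetP=> x; rewrite !inE => /andP[xM /eqP rx].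
    by rewrite xM (subsetP MB) // rx leqnn.
  rewrite -(ler_pM2l (pos (m * j.+1)%N)) mulrA -exprD -e2 exprS -mulrA [leRHS]mulrCA.
  by rewrite ler_pM2l.
rewrite (partition_big (rank_level B) predT) //= [\sum_(x in B) _](partition_big (rank_level B) predT) //=.
rewrite big_ord_recl /= big1 ?add0r => [|x /andP[xM /eqP rx]]; last first.
  have := Msmall ord0; rewrite muln0 expn0 ltnS leqn0 cards_eq0 => /eqP/setP/(_ x).
  by rewrite !inE xM (subsetP MB) // rx leqnn.
rewrite !mulr_sumr big_ord_recr /= -[leLHS]addr0; apply: lerD; last first.
  by rewrite mulr_ge0 // sumr_ge0.
by apply: ler_sum => j _; exact: (step j (ltn_ord j)).
Qed.
End Ranking.

(** * The random subset as a union of rounds *)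

Section Selector.
Variables (R : realType) (X : finType) (p q th : R) (m : nat).
Hypotheses (p_gt0 : 0 < p) (p_le1 : p <= 1) (m_gt0 : (0 < m)%N).
Let n := (3 * m)%N.

(* The last colour [n] stands for the absence of colour. *)
Definition round_weight (k : 'I_n.+1) : R := if (k < n)%N then p / n%:R else 1 - p.

Definition rounds : {set 'I_n.+1} := [set k : 'I_n.+1 | (k < n)%N].

Lemma card_rounds : #|rounds| = n.
Proof.
apply: (@etrans _ _ #|[set~ (ord_max : 'I_n.+1)]|); last by rewrite cardsC1 card_ord.
apply: eq_card => k; rewrite !inE -val_eqE /=; have := ltn_ord k; rewrite ltnS; lia.
Qed.

Lemma round_weight_ge0 k : 0 <= round_weight k.
Proof.
by rewrite /round_weight; case: ifP => _; [rewrite divr_ge0 // ltW|rewrite subr_ge0].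
Qed.

Lemma round_weight_rounds : \sum_(k in rounds) round_weight k = p.
Proof.
rewrite (eq_bigr (fun=> p / n%:R)) => [|k]; last by rewrite inE /round_weight => ->.
rewrite sumr_const card_rounds -[LHS]mulr_natr divfK // pnatr_eq0 /n; lia.
Qed.

Lemma round_weight_never : \sum_(k | k \notin rounds) round_weight k = 1 - p.
Proof.
rewrite (big_pred1 ord_max) => [|k]; first by rewrite /round_weight /= ltnn.
by rewrite inE /= -val_eqE /=; have := ltn_ord k; rewrite ltnS; lia.
Qed.

Lemma round_weight_sum : \sum_k round_weight k = 1.
Proof.
by rewrite (bigID (mem rounds)) /= round_weight_rounds round_weight_never addrC subrK.
Qed.

Lemma random_subset_rounds (g : {set X} -> R) :
  \sum_(t : {ffun X -> 'I_n.+1}) colouring_pmf round_weight t * g [set x | t x \in rounds] =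
  \sum_A random_subset_pmf p A * g A.
Proof.
rewrite (partition_big (fun t : {ffun X -> 'I_n.+1} => [set x | t x \in rounds]) predT) //=.
apply: eq_bigr => A _.
rewrite (eq_bigr (fun t => colouring_pmf round_weight t * g A)) => [|t /eqP -> //].
rewrite -mulr_suml; congr (_ * _).
rewrite (eq_bigl (fun t => t \in family (fun x => [pred k | (k \in rounds) == (x \in A)]))); last first.
  move=> t; apply/eqP/familyP => [<- x|h]; first by rewrite !inE.
  by apply/setP=> x; have := h x; rewrite !inE => /eqP.
rewrite colouring_pmf_family; apply: eq_bigr => x _; case: ifP => _.
  by rewrite -[RHS]round_weight_rounds; apply: eq_bigl => k; rewrite /= eqb_id.
by rewrite -[RHS]round_weight_never; apply: eq_bigl => k; rewrite /= eqbF_neg.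
Qed.

Hypotheses (th_eq : th = 256^-1) (q_ge0 : 0 <= q) (q_le : q <= p / n%:R * th ^+ 4).

(** With all [3 * m] rounds, failure has probability at most $2^{-m}$; otherwise some [B] in [H]
    keeps a fraction $1 - 2^{1-m}$ of its weight by [missing_weight]. *)
Lemma expectation_ge (H : {set {set X}}) (lam : {set X} -> X -> R) (g : {set X} -> R) (v : R) :
  ~ q_small q H -> (forall A x, 0 <= lam A x) -> 0 <= v ->
  (forall A, A \in H -> v <= \sum_(x in A) lam A x) ->
  (forall A W : {set X}, A \in H -> \sum_(x in W) lam A x <= g W) -> (forall W, 0 <= g W) ->
  (1 - 2^-1 ^+ m) * ((1 - 2 * 2^-1 ^+ m) * v) <= \sum_W random_subset_pmf p W * g W.
Proof.
move=> ns lam0 v0 lamv lamg g0; rewrite -random_subset_rounds.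
set r := rank_level m lam.
have cover (G : {set {set X}}) : (forall A, A \in H -> exists2 B, B \in G & B \subset A) ->
    2^-1 < \sum_(B in G) q ^+ #|B|.
  by move=> cG; rewrite ltNge; apply/negP=> h; apply: ns; exists G.
have n0 : 0 < n%:R :> R by rewrite ltr0n /n; lia.
have pf := @fail_prob R X _ round_weight round_weight_ge0 round_weight_sum m #|X|.+1 m_gt0 H r
  (fun B j _ => card_rank_level m_gt0 lam B j) q (p / n%:R) th rounds (divr_gt0 p_gt0 n0).
have {pf} := pf _ th_eq q_ge0 q_le cover rounds (subxx _).
rewrite card_rounds (_ : n - 2 * m = m)%N; last by rewrite /n; lia.
have wr k : k \in rounds -> round_weight k = p / n%:R by rewrite inE /round_weight => ->.
move=> /(_ wr) pf.
have e0 : 0 <= 1 - 2 * 2^-1 ^+ m :> R.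
  have : 2^-1 ^+ m <= 2^-1 ^+ 1 :> R by rewrite ler_wiXn2l //; lra.
  by rewrite expr1; lra.
have good t : ~~ fail m H r rounds t -> (1 - 2 * 2^-1 ^+ m) * v <= g [set x | t x \in rounds].
  rewrite negb_forall => /existsP[B]; rewrite negb_imply negb_exists => /andP[BH /forallP miss].
  pose M := [set x in B | t x \notin rounds].
  have MB : M \subset B by apply/subsetP=> x; rewrite inE => /andP[].
  have := @missing_weight R X m m_gt0 lam lam0 B M MB => /(_ _) mw.
  have {}mw : 2 ^+ m * \sum_(x in M) lam B x <= 2 * \sum_(x in B) lam B x.
    apply: mw => j; have := miss j; rewrite -ltnNge; apply: leq_ltn_trans.
    by apply/subset_leq_card/subsetP=> x; rewrite !inE => /andP[-> /andP[_ ->]].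
  apply: le_trans (lamg B _ BH).
  have split : \sum_(x in B) lam B x <= \sum_(x in M) lam B x + \sum_(x in [set x | t x \in rounds]) lam B x.
    rewrite (bigID (fun x => t x \in rounds)) /= addrC; apply: lerD.
      by rewrite le_eqVlt; apply/orP; left; apply/eqP; apply: eq_bigl => x; rewrite !inE.
    rewrite big_mkcond [leRHS]big_mkcond; apply: ler_sum => x _.
    by rewrite [x \in [set _ | _]]inE; case: (t x \in rounds); case: (x \in B).
  have vB := lamv B BH.
  have mw' : \sum_(x in M) lam B x <= 2 * 2^-1 ^+ m * \sum_(x in B) lam B x.
    rewrite -(ler_pM2l (_ : 0 < 2 ^+ m)) ?exprn_gt0 //; apply: le_trans mw _.
    rewrite le_eqVlt; apply/orP; left; apply/eqP.
    by rewrite -[2 * 2^-1 ^+ m * _]mulrA mulrCA [2 ^+ m * _]mulrA -exprMn mulfV ?pnatr_eq0 // expr1n mul1r.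
  apply: (@le_trans _ _ ((1 - 2 * 2^-1 ^+ m) * \sum_(x in B) lam B x)); first exact: ler_wpM2l.
  by rewrite mulrBl mul1r; lra.
rewrite (bigID (fail m H r rounds)) /= -[leLHS]add0r; apply: lerD.
  by apply: sumr_ge0 => t _; rewrite mulr_ge0 // colouring_pmf_ge0 //; exact: round_weight_ge0.
apply: (@le_trans _ _ (\sum_(t | ~~ fail m H r rounds t) colouring_pmf round_weight t * ((1 - 2 * 2^-1 ^+ m) * v))).
  rewrite -mulr_suml; apply: ler_wpM2r; first by rewrite mulr_ge0.
  have : \sum_(t : {ffun X -> 'I_n.+1}) colouring_pmf round_weight t = 1.
    by rewrite -(bigA_distr_bigA (fun _ k => round_weight k)) big1 // => x _; rewrite round_weight_sum.
  by rewrite (bigID (fail m H r rounds)) /=; lra.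
apply: ler_sum => t /good; apply: ler_wpM2l; apply: colouring_pmf_ge0; exact: round_weight_ge0.
Qed.
End Selector.

From mathcomp Require Import all_classical all_reals all_analysis.

(** * Positivity and finiteness of [Z] *)

Section Z_facts.
Variables (R : realType) (X : finType) (Lambda : set (X -> R)).
Hypothesis Lambda_ge0 : forall l, Lambda l -> forall x, 0 <= l x.

Lemma Z_ge (A : {set X}) l : Lambda l -> ((\sum_(x in A) l x)%:E <= Z Lambda A)%E.
Proof. by move=> Ll; apply: ereal_sup_ubound; exists l. Qed.

Lemma Z_le_setT (A : {set X}) : (Z Lambda A <= Z Lambda [set: X]%SET)%E.
Proof.
apply: ge_ereal_sup => _ [l Ll <-]; apply: le_trans (Z_ge _ Ll).
rewrite lee_fin big_mkcond [leRHS]big_mkcond; apply: ler_sum => x _.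
by rewrite finset.in_setT; case: ifP => // _; apply: Lambda_ge0.
Qed.

Lemma Z_ge0 (A : {set X}) : (Lambda !=set0)%classic -> (0 <= Z Lambda A)%E.
Proof.
move=> [l Ll]; apply: le_trans (Z_ge _ Ll).
by rewrite lee_fin; apply: sumr_ge0 => x _; apply: Lambda_ge0.
Qed.

Lemma random_subset_pmf_ge0 (p : R) (A : {set X}) : 0 <= p <= 1 -> 0 <= random_subset_pmf p A.
Proof. by move=> /andP[p0 p1]; apply: prodr_ge0 => x _; case: ifP => _ //; rewrite subr_ge0. Qed.

(** The full set has positive probability and the largest value of [Z], so a finite expectation
    bounds them all. *)
Lemma Z_fin (p : R) (A : {set X}) : 0 < p <= 1 -> (Lambda !=set0)%classic ->
  (expect_random_subset p (Z Lambda) < +oo)%E -> Z Lambda A \is a fin_num.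
Proof.
move=> /andP[p0 p1] L0 Efin; rewrite ge0_fin_numE ?Z_ge0 //.
apply: le_lt_trans (Z_le_setT A) _; rewrite ltey; apply/eqP => ZT.
have pos (B : {set X}) : (0 <= (random_subset_pmf p B)%:E * Z Lambda B)%E.
  by rewrite mule_ge0 ?Z_ge0 // lee_fin random_subset_pmf_ge0 // ltW.
move: Efin; rewrite /expect_random_subset (bigD1 [set: X]%SET) //= ZT gt0_muley; last first.
  by rewrite lte_fin; apply: prodr_gt0 => x _; rewrite finset.in_setT.
by rewrite addye ?ltxx // -ltNye (@lt_le_trans _ _ 0%E) ?ltNy0 ?sume_ge0.
Qed.
End Z_facts.

(** * Choice of the parameters and contradiction *)

Theorem corollary1p5 (R : realType) :
  exists2 c : R, 0 < c &
    forall (X : finType) (p : R) (Lambda : set (X -> R)),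
      0 < p <= 1 ->
      (forall l, Lambda l -> forall x, 0 <= l x) ->
      (expect_random_subset p (Z Lambda) < +oo)%E ->
      forall delta : R, 0 < delta <= 1 ->
        q_small (c * p / log2 (2 / delta))
          [set A : {set X} |
            ((1 + delta)%:E * expect_random_subset p (Z Lambda)
               < Z Lambda A)%E]%SET.
Proof.
have [th th_eq] : exists th : R, th = 256^-1 by exists 256^-1.
have [k k0 kE] : exists2 k : R, 0 < k & k = th ^+ 4.
  by exists (th ^+ 4); [apply: exprn_gt0; rewrite th_eq invr_gt0 ltr0n|exact: erefl].
(* $12 = 3 \cdot 4$: there are [3 * m] rounds, and [m <= 4 * L] below. *)
exists (k / 12); first by rewrite divr_gt0.
move=> X p Lambda p01 L_ge0 Efin delta /andP[d0 d1].
set q := _ / log2 _; set H := finset _.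
have [//|ns] := pselect (q_small q H).
have [A0 A0H] : exists A0, A0 \in H.
  have [H0|[A0 A0H]] := finset.set_0Vmem H; last by exists A0.
  exfalso; apply: ns; exists finset.set0; first by move=> A; rewrite H0 finset.in_set0.
  by rewrite big_pred0 ?invr_ge0 // => A; rewrite finset.in_set0.
have L0 : (Lambda !=set0)%classic.
  apply/set0P/eqP => L0; move: A0H; rewrite finset.in_set /Z L0 image_set0 ereal_sup0.
  by rewrite ltNge leNye.
pose g A := fine (Z Lambda A).
have gE A : Z Lambda A = (g A)%:E by rewrite fineK // (Z_fin L_ge0 A p01 L0 Efin).
have [p0 p1] := andP p01.
pose M := \sum_A random_subset_pmf p A * g A.
have EM : expect_random_subset p (Z Lambda) = M%:E.
  by rewrite /expect_random_subset -sumEFin; apply: eq_bigr => A _; rewrite gE.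
have g0 A : 0 <= g A by rewrite -lee_fin -gE Z_ge0.
have M0 : 0 <= M.
  by apply: sumr_ge0 => A _; rewrite mulr_ge0 // random_subset_pmf_ge0 // ltW.
have wit (A : {set X}) : exists l : X -> R, Lambda l /\
    (A \in H -> (1 + delta) * M < \sum_(x in A) l x).
  have [AH|AH] := boolP (A \in H); last by have [l Ll] := L0; exists l.
  move: (AH); rewrite finset.in_set EM -EFinM => /ereal_sup_gt[_ [l Ll <-]].
  by rewrite lte_fin; exists l.
have [lam lamP] := choice wit.
pose S (A : {set X}) := \sum_(x in A) lam A x.
(* The least witnessed weight bounds the others from below and still exceeds [(1 + delta) * M]
   strictly. *)
case: (@arg_minP _ _ _ A0 (mem H) S A0H) => A1 A1H Smin.
have S1 : (1 + delta) * M < S A1 by apply: (lamP A1).2.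
have S0 : 0 <= S A1 by apply: ltW; apply: le_lt_trans S1; rewrite mulr_ge0 // addr_ge0 // ltW.
have ln2 : 0 < ln 2 :> R by rewrite ln_gt0 // ltr1n.
pose L := log2 (2 / delta).
have L1 : 1 <= L.
  rewrite /L /log2 ler_pdivlMr // mul1r ler_ln ?posrE ?divr_gt0 //.
  by rewrite ler_pdivlMr //; lra.
(* $L + 2 < m$ gives $2^{-m} \le \delta / 8$, and $m \le L + 3 \le 4L$ as $L \ge 1$. *)
pose m := (Num.trunc (L + 2)).+1.
have mL : m%:R <= 4 * L.
  have /truncn_itv/andP[h _] : 0 <= L + 2 by lra.
  by rewrite /m -addn1 natrD; lra.
have m_ge : 2^-1 ^+ m <= delta / 8.
  have h : L + 2 < m%:R by apply: truncnS_gt.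
  have : 8 / delta <= 2 ^+ m.
    rewrite -ler_ln ?posrE ?exprn_gt0 ?divr_gt0 // lnXn // -[leRHS]mulr_natl.
    have -> : 8 / delta = 2 ^+ 2 * (2 / delta) by field; lra.
    rewrite lnM ?posrE ?exprn_gt0 ?divr_gt0 // lnXn // -[X in X + _]mulr_natl.
    have -> : ln (2 / delta) = L * ln 2 by rewrite /L /log2 divfK // gt_eqF.
    nra.
  rewrite exprVn -[delta / 8]invrK lef_pV2 ?posrE ?exprn_gt0 ?invr_gt0 ?divr_gt0 //.
  by rewrite invf_div.
have mpos : (0 < 3 * m)%N by rewrite /m.
have q_le : q <= p / (3 * m)%:R * th ^+ 4.
  rewrite -kE /q -/L ler_pdivrMr; last exact: lt_le_trans L1.
  have -> : p / (3 * m)%:R * k * L = (k * p) * (L / (3 * m)%:R).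
    by move: ((3 * m)%:R^-1) => a; ring.
  have -> : k / 12 * p = k * p * 12^-1 by rewrite mulrAC.
  apply: ler_wpM2l; first by rewrite mulr_ge0 // ltW.
  by rewrite ler_pdivlMr ?ltr0n // natrM; clear -mL; lra.
have q0 : 0 <= q.
  by apply: divr_ge0; [rewrite ltW // !mulr_gt0 // invr_gt0 | exact: le_trans ler01 L1].
have := @expectation_ge R X p q th m p0 p1 isT th_eq q0 q_le H lam g (S A1) ns
  (fun A => L_ge0 _ (lamP A).1) S0 (fun A => Smin A).
rewrite -/M => /(_ _ g0) h; exfalso.
have {}h : (1 - 2^-1 ^+ m) * ((1 - 2 * 2^-1 ^+ m) * S A1) <= M.
  by apply: h => A W AH; rewrite -lee_fin -gE; apply: Z_ge; exact: (lamP A).1.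
move: h m_ge S1; have : 0 < 2^-1 ^+ m :> R by rewrite exprn_gt0.
move: (2^-1 ^+ m) (S A1) S0 => e v v0 e0 h ed v1.
have le1 : (1 - delta / 8) * ((1 - delta / 4) * v) <= M.
  apply: le_trans h; apply: ler_pM; [lra| |lra|].
    by rewrite mulr_ge0 //; lra.
  by apply: ler_wpM2r => //; lra.
pose k' := (1 - delta / 8) * (1 - delta / 4).
have k'0 : 0 < k' by rewrite mulr_gt0 //; lra.
(* The losses $\delta/8$ and $\delta/4$ are outweighed by the gain $1 + \delta$ for $\delta \le 1$,
   whence [M < M]. *)
have k'1 : 1 <= k' * (1 + delta) by rewrite /k'; nra.
have : k' * ((1 + delta) * M) < k' * v by rewrite ltr_pM2l.
have : 1 * M <= (k' * (1 + delta)) * M by apply: ler_wpM2r.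
move: le1; rewrite mulrA -/k'; lra.
Qed.
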